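(* Let $1\le p,q<\infty$ with $\frac1p+\frac1q=1$, and suppose $E(|w|^p)^{1/p}E(|u|^q)^{1/q}<\infty$ a.e. Then the linear transformation $M_wEM_u$ is densely defined, i.e. its domain $\mathcal{D}(M_wEM_u)=\{f\in L^p(\Sigma): wE(uf)\in L^p(\Sigma)\}$ is dense in $L^p(\Sigma)$.
   Context: $(\Omega,\Sigma,\mu)$ is a $\sigma$-finite measure space and $\mathcal{A}\subseteq\Sigma$ is a $\sigma$-subalgebra such that $(\Omega,\mathcal{A},\mu)$ is also $\sigma$-finite. $L^p(\Sigma)=L^p(\mu)=L^p(\Omega,\Sigma,\mu)$ (complex-valued functions). Comparisons between functions or sets hold up to $\mu$-null sets. $E=E^{\mathcal{A}}$ is the conditional expectation with respect to $\mathcal{A}$: for $f\ge0$ $\Sigma$-measurable (then $E(f)$ may take values in $[0,\infty]$) or $f\in L^p(\Sigma)$, $E(f)$ is the unique $\mathcal{A}$-measurable function with $\int_A f\,d\mu=\int_A E(f)\,d\mu$ for all $A\in\mathcal{A}$ for which the integrals exist. For a general complex-valued $\Sigma$-measurable $f$, $E(f)$ is understood to be defined when $E(|f|)<\infty$ a.e. (by linearity from nonnegative functions). The functions $u,w:\Omega\to\mathbb{C}$ are $\Sigma$-measurable and conditionable, i.e. $E(u)$ and $E(w)$ are defined. The weighted conditional type (WCT) operator $M_wEM_u$ in $L^p(\Sigma)$ is $f\mapsto wE(uf)$ with domain $\{f\in L^p(\Sigma): wE(uf)\in L^p(\Sigma)\}$ (which includes the requirement that $E(uf)$ is defined). *)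

(* Defs.v *)
From mathcomp Require Import all_boot all_order all_algebra.
From mathcomp Require Import all_classical all_reals all_analysis.
From mathcomp Require Import measurable_realfun.
From mathcomp Require Export complex.
Set Implicit Arguments.
Unset Strict Implicit.
Unset Printing Implicit Defensive.
Import Order.TTheory GRing.Theory Num.Theory.
Local Open Scope classical_set_scope.
Local Open Scope ring_scope.
Local Open Scope complex_scope.

Section complex_Lp.
Context {d : measure_display} {T : measurableType d} {R : realType}.
Variable mu : {measure set T -> \bar R}.

(* Borel measurability of [f : T -> C]: the Borel sigma-algebra of C is that of
   R x R. *)
Definition cmeasurable (f : T -> R[i]) : Prop :=
  measurable_fun [set: T] (fun x => complex.Re (f x)) /\
  measurable_fun [set: T] (fun x => complex.Im (f x)).

(* [Normc.normc] is the modulus with values in [R]; the norm [`|z|] takes values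
   in [R[i]]. *)
Definition cLnorm (p : R) (f : T -> R[i]) : \bar R :=
  Lnorm mu p%:E (fun x => (Normc.normc (f x))%:E).

(* Elements of L^p are represented by functions, without quotienting by
   almost-everywhere equality. *)
Definition cLp (p : R) : set (T -> R[i]) :=
  [set f | cmeasurable f /\ (cLnorm p f < +oo)%E].

Definition dense_in_cLp (p : R) (D : set (T -> R[i])) : Prop :=
  D `<=` cLp p /\
  forall f, cLp p f -> forall e : R, 0 < e ->
    exists2 g, D g & (cLnorm p (fun x => (f x - g x)%R) < e%:E)%E.

End complex_Lp.

Section conditional_expectation.
Context {d : measure_display} {T : measurableType d} {R : realType}.
Variables (mu : {measure set T -> \bar R}) (A : set (set T)).
Local Open Scope ereal_scope.

Definition sub_sigma_algebra_of_measurable : Prop :=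
  sigma_algebra [set: T] A /\ A `<=` measurable.

Definition sigma_finite_on : Prop :=
  @sigma_finite _ (g_sigma_algebraType A) R [set: T] mu.

(* [g] is a version of E(f), for [f] nonnegative; the integrals, taken over the
   ambient sigma-algebra, may be infinite. *)
Definition is_condexp (f g : T -> \bar R) : Prop :=
  [/\ measurable_fun setT (g : g_sigma_algebraType A -> \bar R),
      forall x, 0 <= g x &
      forall B, A B -> \int[mu]_(x in B) f x = \int[mu]_(x in B) g x].

(* A chosen version; for [f] nonnegative and measurable, and [mu] sigma-finite on
   [A], one exists by Radon-Nikodym and is unique up to null sets. *)
Definition condexp_ge0 (f : T -> \bar R) : T -> \bar R :=
  xget (cst 0) [set g | is_condexp f g].

Definition conditionable (f : T -> R[i]) : Prop :=
  {ae mu, forall x, condexp_ge0 (fun y => (Normc.normc (f y))%:E) x < +oo}.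

Definition condexp_real (f : T -> R) (x : T) : R :=
  (fine (condexp_ge0 ((EFin \o f)^\+)%E x) -
   fine (condexp_ge0 ((EFin \o f)^\-)%E x))%R.

(* Relevant only for [f] measurable and conditionable: then the nonnegative parts
   have almost everywhere finite conditional expectations and [fine] discards
   nothing. *)
Definition condexp (f : T -> R[i]) (x : T) : R[i] :=
  condexp_real (fun y => complex.Re (f y)) x +i*
  condexp_real (fun y => complex.Im (f y)) x.

Definition wct (w u f : T -> R[i]) (x : T) : R[i] :=
  (w x * condexp (fun y => (u y * f y)%R) x)%R.

Definition wct_domain (p : R) (w u : T -> R[i]) : set (T -> R[i]) :=
  [set f | [/\ cLp mu p f,
               conditionable (fun y => (u y * f y)%R) &
               cLp mu p (wct w u f)]].

End conditional_expectation.

(* Main.v *)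
From HB Require Import structures.
Require Import Defs.
From mathcomp Require Import all_boot all_order all_algebra.
From mathcomp Require Import all_classical all_reals all_analysis.
From mathcomp Require Import measurable_realfun lra.
Set Implicit Arguments.
Unset Strict Implicit.
Unset Printing Implicit Defensive.
Import Order.TTheory GRing.Theory Num.Theory.
Import numFieldNormedType.Exports.
Local Open Scope classical_set_scope.
Local Open Scope ring_scope.

(** Write W = E(|w|^p) and U = E(|u|); both are versions with values in
    [0, +oo], and U is finite a.e. because u is conditionable. Given f in L^p,
    truncate it to the set F_n on which |f| <= n, U <= n, W is either <= n or
    infinite, and x lies in the n-th set G_n of an increasing sequence of
    A-measurable sets of finite measure that exhausts the space. Almost every
    point lies in F_n for n large, so f 1_{F_n} tends to f in L^p by dominated
    convergence ([cLp_patch_approx]). It remains to see that f 1_{F_n} belongs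
    to the domain.

    The integrability assumption enters in one place only. Where W = +oo, the
    finiteness of W^(1/p) E(|u|^q)^(1/q) forces E(|u|^q) = 0; this set is
    A-measurable, so the integral of |u|^q over it vanishes and u = 0 a.e. there
    ([ae_eq0_where_condexp_infinite]). Consequently |u f 1_{F_n}| is dominated
    a.e. by n |u| 1_D, where D = G_n, U <= n, W <= n is A-measurable. Taking
    conditional expectations, which is monotone ([is_condexp_le]) and commutes
    with multiplication by 1_D ([is_condexp_restrict]), gives
    |E(u f 1_{F_n})| <= 2 n U 1_D <= 2 n^2 1_D. Hence E(u f 1_{F_n}) is defined,
    and
      int |w|^p |E(u f 1_{F_n})|^p <= (2 n^2)^p int_D |w|^p
                                    = (2 n^2)^p int_D W <= (2 n^2)^p n mu(G_n),
    which is finite ([wct_domain_dominated]). Since the truncation makes f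
    bounded, the crude bound by E(|u|) replaces the conditional Hoelder
    inequality.

    All this presupposes that the chosen versions of the conditional
    expectations have the defining property, that is, that versions exist for
    every nonnegative measurable function, even when its integrals over
    A-measurable sets of finite measure are infinite. For integrable functions
    this is the Radon-Nikodym theorem for the restriction of mu to A; in general
    the function is cut into countably many integrable pieces, and the versions
    for the pieces are summed ([is_condexp_exists]). *)

(** * Existence of conditional expectations *)

Section indefinite_integral.
Context d (T : measurableType d) d' (T' : measurableType d') (R : realType).
Variables (mu : {measure set T -> \bar R}) (phi : T -> T') (f : T -> \bar R).
Hypotheses (mphi : measurable_fun setT phi) (f0 : (forall x, 0 <= f x)%E).
Hypothesis intf : mu.-integrable setT f.
Local Open Scope ereal_scope.

(** For phi the identity into a coarser sigma-algebra this is the measure with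
    density f, restricted to that sigma-algebra. The proofs are arguments so that
    the measure instances below, which depend on them, can be found by
    unification. *)
Definition indefinite_integral of measurable_fun setT phi & (forall x, 0 <= f x)
    & mu.-integrable setT f :=
  fun B : set T' => \int[mu]_(x in phi @^-1` B) f x.

Local Notation nu := (indefinite_integral mphi f0 intf).

Let nu0 : nu set0 = 0.
Proof. by rewrite /indefinite_integral preimage_set0 integral_set0. Qed.

Let nu_ge0 B : 0 <= nu B.
Proof. exact: integral_ge0. Qed.

Let mphiT B : measurable B -> measurable (phi @^-1` B).
Proof. by move=> mB; rewrite -[X in measurable X]setTI; exact: mphi. Qed.

Let nu_sigma_additive : semi_sigma_additive nu.
Proof.
move=> F mF tF mUF; rewrite /indefinite_integral preimage_bigcup.
rewrite ge0_integral_bigcup//.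
- by apply: is_cvg_nneseries => n _ _; exact: integral_ge0.
- by move=> n; exact: mphiT.
- by apply: measurable_funTS; exact: measurable_int intf.
- apply/trivIsetP => /= i j _ _ ij; rewrite -preimage_setI.
  by move/trivIsetP : tF => /(_ _ _ _ _ ij) ->//; rewrite preimage_set0.
Qed.

HB.instance Definition _ := isMeasure.Build _ _ _ nu nu0 nu_ge0 nu_sigma_additive.

Let nu_fin : fin_num_fun nu.
Proof.
move=> B mB; rewrite ge0_fin_numE//.
have /integrableP[mf] := intf; apply: le_lt_trans.
apply: (@le_trans _ _ (\int[mu]_x f x)).
  by apply: ge0_subset_integral => //; exact: mphiT.
by apply: ge0_le_integral => // [|x _]; [exact: measurableT_comp|exact: lee_abs].
Qed.

HB.instance Definition _ := Measure_isFinite.Build _ _ _ nu nu_fin.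

End indefinite_integral.

Section sub_sigma_algebra.
Context d (T : measurableType d) (R : realType).
Variables (mu : {measure set T -> \bar R}) (A : set (set T)).
Hypothesis subA : sub_sigma_algebra_of_measurable A.
Local Open Scope ereal_scope.

Local Notation TA := (g_sigma_algebraType A).

Lemma g_sigma_measurableE (B : set T) : measurable (B : set TA) = A B.
Proof. by rewrite -[in RHS](measurable_g_measurableTypeE subA.1). Qed.

Lemma measurable_id_sub : measurable_fun setT (id : T -> TA).
Proof.
move=> _ B mB; rewrite setTI preimage_id; apply: subA.2.
by rewrite -g_sigma_measurableE.
Qed.

Lemma measurable_fun_sub d' (T' : measurableType d') (f : TA -> T') :
  measurable_fun setT f -> measurable_fun setT (f : T -> T').
Proof. by move=> mf; exact: (measurableT_comp mf measurable_id_sub). Qed.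

Hypothesis sfA : sigma_finite_on mu A.

(** A separate constant, so that [mu] on [A] can carry its own sigma-finiteness
    instance; the proofs are arguments for the sake of the instances. *)
Definition sub_measure of sub_sigma_algebra_of_measurable A &
  sigma_finite_on mu A : set TA -> \bar R := mu.

Local Notation muA := (sub_measure subA sfA).

Let muA0 : muA set0 = 0. Proof. exact: measure0. Qed.

Let muA_ge0 B : 0 <= muA B. Proof. exact: measure_ge0. Qed.

Let muA_sigma_additive : semi_sigma_additive muA.
Proof.
move=> F mF tF mUF; apply: measure_semi_sigma_additive => //.
  by move=> n; apply: subA.2; rewrite -g_sigma_measurableE.
by apply: subA.2; rewrite -g_sigma_measurableE.
Qed.

HB.instance Definition _ := isMeasure.Build _ _ _ muA
  muA0 muA_ge0 muA_sigma_additive.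

HB.instance Definition _ := Measure_isSigmaFinite.Build _ _ _ muA sfA.

Lemma integral_sub_measure (B : set T) (g : TA -> \bar R) :
  A B -> measurable_fun setT g -> (forall x, 0 <= g x) ->
  \int[muA]_(x in B) g x = \int[mu]_(x in B) g x.
Proof.
move=> AB mg g0; have mB : measurable (B : set TA) by rewrite g_sigma_measurableE.
have := @ge0_integral_pushforward _ _ T TA R id measurable_id_sub mu B g mB
  (measurable_funTS mg) (fun y _ => g0 y).
rewrite preimage_id => <-.
by [].
Qed.

(** Radon-Nikodym, applied on [A] to the finite measure B |-> int_B f, which is
    absolutely continuous with respect to the restriction of [mu]. *)
Lemma is_condexp_exists_integrable (f : T -> \bar R) :
  (forall x, 0 <= f x) -> mu.-integrable setT f ->
  exists g, is_condexp mu A f g.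
Proof.
move=> f0 intf; pose nu := indefinite_integral measurable_id_sub f0 intf.
have nu_mu : nu `<< muA.
  apply/null_content_dominatesP => /= B mB muB0.
  rewrite /nu /indefinite_integral preimage_id; apply: null_set_integral => //.
  - by apply: subA.2; rewrite -g_sigma_measurableE.
  - by apply: measurable_funTS; exact: measurable_int intf.
have [g [g0 _ intg nug]] := radon_nikodym_sigma_finite nu_mu.
have mg := measurable_int _ intg.
exists g; split => // B AB.
have mB : measurable (B : set TA) by rewrite g_sigma_measurableE.
transitivity (nu B); first by rewrite /nu /indefinite_integral preimage_id.
by rewrite [LHS](nug B mB); exact: integral_sub_measure.
Qed.

Lemma sub_sigma_finite_seq : exists F : (set T)^nat,
  [/\ \bigcup_n F n = setT, nondecreasing_seq F, forall n, A (F n) &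
      forall n, mu (F n) < +oo].
Proof.
have /sigma_finiteP[F [TF ndF mF]] : sigma_finite setT muA by [].
exists F; split => // n; last by have [] := mF n.
by rewrite -g_sigma_measurableE; have [] := mF n.
Qed.

(** The space is partitioned into measurable sets D_n on which f is integrable
    (f is bounded there and D_n has finite measure), and the versions for
    f 1_{D_n} are summed. Summing a series of nonnegative functions, rather
    than passing to the limit along truncations of f, avoids having to compare
    the versions with each other, which would only be possible a.e. *)
Lemma is_condexp_exists (f : T -> R) :
  measurable_fun setT f -> (forall x, 0 <= f x)%R ->
  exists g, is_condexp mu A (EFin \o f) g.
Proof.
move=> mf f0; have mEf : measurable_fun setT (EFin \o f) by exact/measurable_EFinP.
have [F [TF ndF AF Foo]] := sub_sigma_finite_seq.
have mF n : measurable (F n) by exact: subA.2.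
pose C n := F n `&` [set x | (f x <= n%:R)%R].
have mC n : measurable (C n).
  apply: measurableI => //; rewrite -[X in measurable X]setTI.
  by rewrite -[X in _ `&` X]/(f @^-1` [set y | (y <= n%:R)%R]) -set_itvNyc; exact: mf.
have CT : \bigcup_n C n = setT.
  apply/seteqP; split => // x _.
  have [n _ Fnx] : (\bigcup_i F i) x by rewrite TF.
  have [m fm] : exists m : nat, (f x <= m%:R)%R.
    by exists (Num.bound (f x)); exact/ltW/archi_boundP.
  exists (maxn n m) => //; split.
    by move: Fnx; apply/subsetPset/ndF; exact: leq_maxl.
  by rewrite /= (le_trans fm)// ler_nat leq_maxr.
(* Making the C n disjoint keeps them inside the sets where f is integrable. *)
pose D := seqDU C.
have mD n : measurable (D n) by apply: measurableD => //; exact: bigsetU_measurable.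
have DT : \bigcup_n D n = setT by rewrite -seqDU_bigcup_eq.
have DC n : D n `<=` C n by exact: subDsetl.
pose h n := (EFin \o f) \_ (D n).
have h0 n x : 0 <= h n x by apply: erestrict_ge0 => t _; rewrite lee_fin.
have inth n : mu.-integrable setT (h n).
  apply/(integrable_mkcond _ (mD n)).1.
  apply: (@le_integrable _ _ _ _ _ _ _ (cst n%:R%:E)) => //.
  - exact: measurable_funTS.
  - by move=> x /DC[_ /= fn]; rewrite !ger0_norm.
  - apply/integrableP; split => //.
    rewrite integral_cst// ger0_norm// lte_mul_pinfty//.
    apply: (@le_lt_trans _ _ (mu (F n))) => //.
    by apply: le_measure; rewrite ?inE// => x /DC[].
have [g gP] := choice (fun n => is_condexp_exists_integrable (h0 n) (inth n)).
exists (fun x => \sum_(n <oo) g n x); split.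
- apply: ge0_emeasurable_sum => //= n.
    by move=> x _ _; have [_ +] := gP n; exact.
  by move=> _; have [+ _] := gP n.
- by move=> x; apply: nneseries_ge0 => n _ _; have [_ +] := gP n; exact.
- move=> B AB; have mB := subA.2 _ AB.
  rewrite integral_nneseries//; last 2 first.
  - move=> n; have [+ _ _] := gP n.
    by move/measurable_fun_sub; exact: measurable_funTS.
  - by move=> n x _; have [_ +] := gP n; exact.
  under eq_eseriesr => n _ do
    (have [_ _ gn] := gP n; rewrite -gn// /h -integral_mkcondr).
  have -> : B = \bigcup_n (B `&` D n) by rewrite -setI_bigcupr DT setIT.
  rewrite ge0_integral_bigcup//.
  - by apply: eq_eseriesr => n _; rewrite -setI_bigcupr DT setIT.
  - by move=> n; exact: measurableI.
  - exact: measurable_funTS.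
  - by move=> x _; rewrite /= lee_fin.
  - by apply: trivIset_setIl; exact: trivIset_seqDU.
Qed.

Lemma condexp_ge0P (f : T -> R) :
  measurable_fun setT f -> (forall x, 0 <= f x)%R ->
  is_condexp mu A (fun x => (f x)%:E) (condexp_ge0 mu A (fun x => (f x)%:E)).
Proof.
move=> mf f0; have [g gP] := is_condexp_exists mf f0.
exact: (xgetPex (cst 0) (ex_intro _ g gP)).
Qed.

End sub_sigma_algebra.

(** * Monotonicity and A-measurable restriction *)

Section condexp_versions.
Context d (T : measurableType d) (R : realType).
Variables (mu : {measure set T -> \bar R}) (A : set (set T)).
Hypothesis subA : sub_sigma_algebra_of_measurable A.
Hypothesis sfA : sigma_finite_on mu A.
Local Open Scope ereal_scope.
Local Notation TA := (g_sigma_algebraType A).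

Lemma sub_setI (B C : set T) : A B -> A C -> A (B `&` C).
Proof.
rewrite -(g_sigma_measurableE subA B) -(g_sigma_measurableE subA C).
rewrite -(g_sigma_measurableE subA (B `&` C)) => mB mC.
exact: (@measurableI _ TA B C mB mC).
Qed.

Lemma is_condexp_restrict (B : set T) (f g : T -> \bar R) :
  A B -> is_condexp mu A f g -> is_condexp mu A (f \_ B) (g \_ B).
Proof.
move=> AB [mg g0 fg]; split.
- apply/(measurable_restrictT _ _).1; first by rewrite (g_sigma_measurableE subA).
  exact: measurable_funTS.
- by move=> x; apply: erestrict_ge0.
- move=> C AC; rewrite -!integral_mkcondr; apply: fg.
  exact: sub_setI.
Qed.

Lemma is_condexpZ (c : R) (f g : T -> \bar R) : (0 <= c)%R ->
  measurable_fun setT f -> (forall x, 0 <= f x) ->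
  is_condexp mu A f g ->
  is_condexp mu A (fun x => c%:E * f x) (fun x => c%:E * g x).
Proof.
move=> c0 mf f0 [mg g0 fg]; split.
- exact: emeasurable_funM.
- by move=> x; rewrite mule_ge0// lee_fin.
- move=> B AB; have mB := subA.2 _ AB.
  rewrite ge0_integralZl//; last exact: measurable_funTS.
  rewrite ge0_integralZl ?fg//.
  by apply: measurable_funTS; exact: (measurable_fun_sub subA mg).
Qed.

(** On an A-measurable set where g' < g and g' is integrable, integrating gives
    int g = int f <= int f' = int g', so g - g' > 0 has integral at most 0 and
    the set is null. By sigma-finiteness of [mu] on [A], countably many such
    sets cover the set where g' < g. *)
Lemma is_condexp_le (f f' g g' : T -> \bar R) :
  measurable_fun setT f -> (forall x, 0 <= f x) ->
  measurable_fun setT f' -> (forall x, 0 <= f' x) ->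
  is_condexp mu A f g -> is_condexp mu A f' g' ->
  {ae mu, forall x, f x <= f' x} -> {ae mu, forall x, g x <= g' x}.
Proof.
move=> mf f0 mf' f'0 [mg g0 fg] [mg' g'0 fg'] ff'.
have [F [TF ndF AF Foo]] := sub_sigma_finite_seq subA sfA.
pose N n := F n `&` ([set x | g' x <= n%:R%:E] `&` [set x | g' x < g x]).
have AN k : A (N k).
  apply: sub_setI => //; apply: sub_setI; rewrite -(g_sigma_measurableE subA).
    by have := emeasurable_fun_infty_c measurableT mg' k%:R%:E; rewrite setTI.
  by have := measurable_lte measurableT mg' mg; rewrite setTI.
have mN n : measurable (N n) by exact: (subA.2 _ (AN n)).
have mgT := measurable_fun_sub subA mg; have mgT' := measurable_fun_sub subA mg'.
have N0 n : mu (N n) = 0.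
  have g'oo : \int[mu]_(x in N n) g' x < +oo.
    apply: (@le_lt_trans _ _ (\int[mu]_(x in N n) (cst n%:R%:E) x)).
      apply: ge0_le_integral => //.
      - exact: measurable_funTS.
      - by move=> x [_ []].
    rewrite integral_cst// lte_mul_pinfty//; apply: le_lt_trans (Foo n).
    by apply: le_measure; rewrite ?inE//; [exact: subA.2|exact: subIsetl].
  have gg' : \int[mu]_(x in N n) g x <= \int[mu]_(x in N n) g' x.
    rewrite -fg// -fg'//; apply: ae_ge0_le_integral => //.
    - exact: measurable_funTS.
    - exact: measurable_funTS.
    - by apply: filterS ff' => x + _.
  have ig' : mu.-integrable (N n) g'.
    apply/integrableP; split; first exact: measurable_funTS.
    by under eq_integral do rewrite gee0_abs//.
  have ig : mu.-integrable (N n) g.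
    apply/integrableP; split; first exact: measurable_funTS.
    by under eq_integral do rewrite gee0_abs//; exact: le_lt_trans gg' g'oo.
  have : \int[mu]_(x in N n) `|(g \- g') x| = 0.
    apply/eqP; rewrite eq_le integral_ge0// andbT.
    rewrite (eq_integral (g \- g')); last first.
      move=> x; rewrite inE => -[_ [_ /= g'g]].
      by rewrite gee0_abs// ltW// sube_gt0.
    rewrite integralB// sube_le0 //.
  have mgg' : measurable_fun (N n) (g \- g').
    by apply: emeasurable_funB; exact: measurable_funTS.
  move/(ae_eq_integral_abs mu (mN n) mgg').1 => [Z [mZ Z0 NZ]].
  apply: (subset_measure0 (mN n) mZ _ Z0) => x Nx; apply: NZ => /= /(_ Nx).
  have [_ [_ /= g'g]] := Nx.
  by move=> gg'0; move: g'g; rewrite -sube_gt0 gg'0 ltxx.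
suff : mu.-negligible (~` [set x | g x <= g' x]) by [].
apply: (@negligibleS _ _ _ mu (\bigcup_n N n)); last first.
  by apply: negligible_bigcup => n; exists (N n); split => //; exact: mN.
move=> x /= /negP; rewrite -ltNge => g'g.
  have [i _ Fix] : (\bigcup_n F n) x by rewrite TF.
  have g'fin : g' x \is a fin_num.
    by rewrite ge0_fin_numE//; apply: lt_le_trans g'g _; exact: leey.
  have [m g'm] : exists m : nat, g' x <= m%:R%:E.
    exists (Num.bound (fine (g' x))); rewrite -(fineK g'fin) lee_fin.
    by apply/ltW/archi_boundP; rewrite fine_ge0.
  exists (maxn i m) => //; split.
    by move: Fix; apply/subsetPset/ndF; exact: leq_maxl.
  by split => //=; apply: le_trans g'm _; rewrite lee_fin ler_nat leq_maxr.
Qed.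

End condexp_versions.

(** * Complex-valued functions and their L^p norms *)

Section complex_functions.
Context d (T : measurableType d) (R : realType).
Implicit Types f g : T -> R[i].

Lemma normc_ge0 (z : R[i]) : 0 <= Normc.normc z.
Proof. by case: z => a b; exact: sqrtr_ge0. Qed.

Lemma normc_absD (z : R[i]) :
  Normc.normc z <= `|complex.Re z| + `|complex.Im z|.
Proof.
case: z => a b /=; rewrite -(ler_pXn2r (n := 2))// ?nnegrE ?sqrtr_ge0 ?addr_ge0//.
rewrite sqr_sqrtr ?addr_ge0 ?sqr_ge0// sqrrD !real_normK ?num_real//.
by rewrite -addrA lerD2l -[leLHS]add0r lerD2r mulrn_wge0// mulr_ge0.
Qed.

Lemma abs_Re_normc (z : R[i]) : `|complex.Re z| <= Normc.normc z.
Proof.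
by case: z => a b /=; rewrite -sqrtr_sqr ler_wsqrtr// lerDl sqr_ge0.
Qed.

Lemma abs_Im_normc (z : R[i]) : `|complex.Im z| <= Normc.normc z.
Proof.
by case: z => a b /=; rewrite -sqrtr_sqr ler_wsqrtr// lerDr sqr_ge0.
Qed.

Lemma measurable_normc f : cmeasurable f ->
  measurable_fun setT (fun x => Normc.normc (f x)).
Proof.
move=> [mRe mIm].
rewrite (_ : (fun _ => _) =
  Num.sqrt \o (fun x => complex.Re (f x) ^+ 2 + complex.Im (f x) ^+ 2)).
  apply: measurableT_comp.
    by apply: continuous_measurable_fun; exact: sqrt_continuous.
  by apply: measurable_funD; exact: measurable_funX.
by apply/funext => x /=; case: (f x).
Qed.

Lemma measurable_normc_powR (r : R) f : cmeasurable f ->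
  measurable_fun setT (fun x => Normc.normc (f x) `^ r).
Proof.
move=> mf; apply: (measurableT_comp (measurable_powR r)).
exact: measurable_normc.
Qed.

Lemma cmeasurableM f g : cmeasurable f -> cmeasurable g ->
  cmeasurable (fun x => f x * g x).
Proof.
move=> [fRe fIm] [gRe gIm]; split.
- rewrite (_ : (fun _ => _) = fun x => complex.Re (f x) * complex.Re (g x) -
    complex.Im (f x) * complex.Im (g x)).
    by apply: measurable_funB; exact: measurable_funM.
  by apply/funext => x; case: (f x); case: (g x).
- rewrite (_ : (fun _ => _) = fun x => complex.Re (f x) * complex.Im (g x) +
    complex.Im (f x) * complex.Re (g x)).
    by apply: measurable_funD; exact: measurable_funM.
  by apply/funext => x; case: (f x); case: (g x).
Qed.

Lemma cmeasurable_patch f (F : set T) : measurable F -> cmeasurable f ->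
  cmeasurable (patch (fun=> 0) F f).
Proof.
move=> mF [fRe fIm]; split.
- rewrite (_ : (fun _ => _) = (fun t => complex.Re (f t)) \_ F).
    by apply/(measurable_restrictT _ mF).1; exact: measurable_funTS.
  by apply/funext => x; rewrite /patch; case: ifP.
- rewrite (_ : (fun _ => _) = (fun t => complex.Im (f t)) \_ F).
    by apply/(measurable_restrictT _ mF).1; exact: measurable_funTS.
  by apply/funext => x; rewrite /patch; case: ifP.
Qed.

Variable mu : {measure set T -> \bar R}.

Lemma cLnormE (p : R) f : cLnorm mu p f =
  ((\int[mu]_x (Normc.normc (f x) `^ p)%:E) `^ p^-1)%E.
Proof.
rewrite /cLnorm unlock; congr (_ `^ _)%E; apply: eq_integral => x _.
by rewrite abse_EFin ger0_norm ?normc_ge0// poweR_EFin.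
Qed.

Lemma integral_normc_ge0 (p : R) f :
  (0 <= \int[mu]_x (Normc.normc (f x) `^ p)%:E)%E.
Proof. by apply: integral_ge0 => x _; rewrite lee_fin powR_ge0. Qed.

Lemma cLnorm_lt (p e : R) f : 0 < p -> 0 < e ->
  (\int[mu]_x (Normc.normc (f x) `^ p)%:E < (e `^ p)%:E)%E ->
  (cLnorm mu p f < e%:E)%E.
Proof.
move=> p0 e0; rewrite cLnormE; have := integral_normc_ge0 p f.
case: (integral _ _ _) => [r| |]//; rewrite lee_fin lte_fin => r0 re.
rewrite poweR_EFin lte_fin.
have -> : e = (e `^ p) `^ p^-1.
  by rewrite -powRrM mulfV ?gt_eqF// powRr1// ltW.
by apply: gt0_ltr_powR; rewrite ?invr_gt0 ?nnegrE ?powR_ge0.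
Qed.

Lemma cLpE (p : R) f : 0 < p ->
  cLp mu p f <->
  cmeasurable f /\ (\int[mu]_x (Normc.normc (f x) `^ p)%:E < +oo)%E.
Proof.
move=> p0; rewrite /cLp /= cLnormE; split => -[mf ioo]; split => //; last first.
  exact: poweR_lty.
rewrite ltey; apply/eqP => ioo'; move: ioo.
by rewrite ioo' poweRyr ?ltxx// invr_neq0// gt_eqF.
Qed.

(** Dominated convergence: the p-th power of |f - f 1_{F_n}| is |f|^p off F_n
    and 0 on F_n, so it is bounded by |f|^p and a.e. eventually 0. *)
Lemma cLp_patch_approx (p : R) f (F : (set T)^nat) : 0 < p ->
  (forall n, measurable (F n)) ->
  {ae mu, forall x, \forall n \near \oo, F n x} ->
  cLp mu p f -> forall e, 0 < e ->
  exists n, (cLnorm mu p (fun x => (f x - patch (fun=> 0) (F n) f x)%R) < e%:E)%E.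
Proof.
move=> p0 mF cvgF /(cLpE _ p0)[mf ioo] e e0.
pose h n x := (Normc.normc (f x - patch (fun=> 0) (F n) f x) `^ p)%:E.
pose k x := (Normc.normc (f x) `^ p)%:E.
have mk : measurable_fun setT k.
  by apply/measurable_EFinP; exact: measurable_normc_powR.
have hE n : h n = k \_ (~` F n).
  apply/funext => x; rewrite /h /k /patch in_setC; case: ifP => /= _.
    by rewrite subrr Normc.normc0 powR0// gt_eqF.
  by rewrite subr0.
have k0 x : (0 <= k x)%E by rewrite lee_fin powR_ge0.
have mh n : measurable_fun setT (h n).
  rewrite hE; apply/(measurable_restrictT _ _).1; first exact: measurableC.
  exact: measurable_funTS.
have [_ _] : [/\ mu.-integrable setT (cst 0%E : T -> \bar R),
    [sequence (\int[mu]_x `|h n x - cst 0 x|)%E]_n @ \oo --> 0%E &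
    [sequence (\int[mu]_x h n x)%E]_n @ \oo --> (\int[mu]_x cst 0 x)%E].
  apply: (@dominated_convergence _ _ _ mu setT measurableT h (cst 0%E) k) => //.
  - apply: filterS cvgF => x Fx _; apply: cvg_near_cst.
    apply: filterS Fx => n Fnx.
    by rewrite hE patchE memNset//= => nF; exact: nF.
  - by apply/integrableP; split => //; under eq_integral do rewrite gee0_abs//.
  - apply: nearW => x n _; rewrite hE patchE; case: ifPn => _.
      by rewrite gee0_abs.
    by rewrite abse0.
rewrite integral0 => cvg0; apply: contrapT => /forallNP nlt.
have ep : (forall n, (e `^ p)%:E <= \int[mu]_x h n x)%E.
  move=> n; rewrite leNgt; apply/negP => hn; apply: (nlt n).
  exact: cLnorm_lt hn.
have : ((e `^ p)%:E <= 0 :> \bar R)%E.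
  rewrite -(cvg_lim _ cvg0)//; apply: lime_ge; first by apply/cvg_ex; exists 0%E.
  exact: nearW.
by rewrite lee_fin leNgt powR_gt0.
Qed.

End complex_functions.

(** * Members of the domain *)

Section wct_domain_members.
Context d (T : measurableType d) (R : realType).
Variables (mu : {measure set T -> \bar R}) (A : set (set T)).
Hypothesis subA : sub_sigma_algebra_of_measurable A.
Hypothesis sfA : sigma_finite_on mu A.
Local Open Scope ereal_scope.

Lemma measurable_condexp_ge0 (f : T -> R) :
  measurable_fun setT f -> (forall x, 0 <= f x)%R ->
  measurable_fun setT (condexp_ge0 mu A (fun x => (f x)%:E)).
Proof.
by move=> mf f0; have [mg _ _] := condexp_ge0P subA sfA mf f0;
  exact: (measurable_fun_sub subA mg).
Qed.

Lemma measurable_condexp_real (f : T -> R) : measurable_fun setT f ->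
  measurable_fun setT (condexp_real mu A f).
Proof.
move=> mf; rewrite /condexp_real funerpos funerneg.
apply: measurable_funB; apply: (measurableT_comp (fine_measurable measurableT)).
  apply: measurable_condexp_ge0; first exact: measurable_funrpos.
  by move=> x; exact: funrpos_ge0.
apply: measurable_condexp_ge0; first exact: measurable_funrneg.
by move=> x; exact: funrneg_ge0.
Qed.

Lemma cmeasurable_condexp (f : T -> R[i]) : cmeasurable f ->
  cmeasurable (condexp mu A f).
Proof. by move=> [fRe fIm]; split; exact: measurable_condexp_real. Qed.

(** In this section |f| <= k, and K is a version of E(k). The bounds also hold
    where K is infinite: [fine] only decreases nonnegative extended reals. *)
Section dominated.
Variables k K : T -> \bar R.
Hypotheses (mk : measurable_fun setT k) (k0 : (forall x, 0 <= k x)).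
Hypothesis kK : is_condexp mu A k K.

Lemma condexp_ge0_le (f : T -> R) :
  measurable_fun setT f -> (forall x, 0 <= f x)%R ->
  {ae mu, forall x, (f x)%:E <= k x} ->
  {ae mu, forall x, condexp_ge0 mu A (fun y => (f y)%:E) x <= K x}.
Proof.
move=> mf f0; apply: (is_condexp_le subA sfA _ _ mk k0 _ kK) => //.
- exact/measurable_EFinP.
- exact: condexp_ge0P.
Qed.

Lemma condexp_real_le (f : T -> R) : measurable_fun setT f ->
  {ae mu, forall x, `|f x|%:E <= k x} ->
  {ae mu, forall x, `|condexp_real mu A f x|%:E <= K x}.
Proof.
move=> mf fk.
have mp := measurable_funrpos mf; have mn := measurable_funrneg mf.
have p0 x : (0 <= f^\+ x)%R by exact: funrpos_ge0.
have n0 x : (0 <= f^\- x)%R by exact: funrneg_ge0.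
have fk_p : {ae mu, forall x, (f^\+ x)%:E <= k x}.
  apply: filterS fk => x; apply: le_trans; rewrite lee_fin /funrpos ge_max.
  by rewrite ler_norm normr_ge0.
have fk_n : {ae mu, forall x, (f^\- x)%:E <= k x}.
  apply: filterS fk => x; apply: le_trans; rewrite lee_fin /funrneg ge_max.
  by rewrite -normrN ler_norm normr_ge0.
have [_ p0' _] := condexp_ge0P subA sfA mp p0.
have [_ n0' _] := condexp_ge0P subA sfA mn n0.
apply: filterS2 (condexp_ge0_le mp p0 fk_p) (condexp_ge0_le mn n0 fk_n).
move=> x; rewrite /condexp_real funerpos funerneg /comp.
move: (p0' x) (n0' x); case: (condexp_ge0 _ _ _ x) => [a| |]//=;
  case: (condexp_ge0 _ _ _ x) => [b| |]//=; case: (K x) => [c| |]//=;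
  rewrite ?lee_fin ?leey// => a0 b0 ac bc.
rewrite ler_norml; apply/andP; split; lra.
Qed.

(** The two copies of K come from the real and the imaginary part. *)
Lemma normc_condexp_le (f : T -> R[i]) : cmeasurable f ->
  {ae mu, forall x, (Normc.normc (f x))%:E <= k x} ->
  {ae mu, forall x, (Normc.normc (condexp mu A f x))%:E <= K x + K x}.
Proof.
move=> [mRe mIm] fk.
have aeRe : {ae mu, forall x, `|complex.Re (f x)|%:E <= k x}.
  by apply: filterS fk => x; apply: le_trans; rewrite lee_fin abs_Re_normc.
have aeIm : {ae mu, forall x, `|complex.Im (f x)|%:E <= k x}.
  by apply: filterS fk => x; apply: le_trans; rewrite lee_fin abs_Im_normc.
apply: filterS2 (condexp_real_le mRe aeRe) (condexp_real_le mIm aeIm) => x hRe hIm.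
apply: le_trans (leeD hRe hIm).
by rewrite -EFinD lee_fin; exact: normc_absD.
Qed.

End dominated.

(** E(u f) is dominated by 2 M E(|u|) 1_D <= 2 M^2 1_D, so it is finite, and the
    L^p norm of w E(u f) is controlled by the integral of |w|^p over D. *)
Lemma wct_domain_dominated (p M : R) (w u f : T -> R[i]) (D : set T) :
  (0 < p)%R -> (0 <= M)%R -> A D -> cmeasurable w -> cmeasurable u ->
  cLp mu p f ->
  \int[mu]_(x in D) (Normc.normc (w x) `^ p)%:E < +oo ->
  {in D, forall x, condexp_ge0 mu A (fun y => (Normc.normc (u y))%:E) x <= M%:E} ->
  {ae mu, forall x, (Normc.normc (u x * f x))%:E <=
    ((fun y => M%:E * (Normc.normc (u y))%:E) \_ D) x} ->
  wct_domain mu A p w u f.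
Proof.
move=> p0 M0 AD mw mu_ fp wD UD uf; have [mf _] := fp.
have mD := subA.2 _ AD.
have muf : cmeasurable (fun x => (u x * f x)%R) by exact: cmeasurableM.
have mnu := measurable_normc mu_.
set k := (X in {ae mu, forall x, _ <= X x}) in uf.
pose U := condexp_ge0 mu A (fun y => (Normc.normc (u y))%:E).
pose K := (fun x => M%:E * U x) \_ D.
have mk : measurable_fun setT k.
  apply/(measurable_restrictT _ mD).1; apply: measurable_funTS.
  by apply: emeasurable_funM => //; exact/measurable_EFinP.
have k0 x : 0 <= k x.
  by apply: erestrict_ge0 => t _; rewrite mule_ge0// lee_fin ?normc_ge0.
have kK : is_condexp mu A k K.
  apply: is_condexp_restrict => //; apply: is_condexpZ => //.
  - exact/measurable_EFinP.
  - by move=> x; rewrite lee_fin normc_ge0.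
  - by apply: condexp_ge0P => // x; exact: normc_ge0.
have KM x : K x <= (cst (M * M)%:E \_ D) x.
  apply: lee_restrict => t Dt; rewrite EFinM; apply: lee_wpmul2l.
    by rewrite lee_fin.
  by apply: UD; rewrite inE.
have c0 x : (0 <= Normc.normc (u x * f x))%R by exact: normc_ge0.
split => //.
- rewrite /conditionable.
  apply: filterS (condexp_ge0_le mk k0 kK (measurable_normc muf) c0 uf) => x Ex.
  apply: (le_lt_trans Ex); apply: (le_lt_trans (KM x)).
  by rewrite patchE; case: ifP => _; rewrite ltry.
- apply/(cLpE _ _ p0); split; first exact/cmeasurableM/cmeasurable_condexp.
  pose c := (M * M + M * M)%R.
  have c_ge0 : (0 <= c)%R by rewrite addr_ge0// mulr_ge0.
  have mwp : measurable_fun setT (fun x => (Normc.normc (w x) `^ p)%:E).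
    by apply/measurable_EFinP; exact: measurable_normc_powR.
  have w0 x : 0 <= (Normc.normc (w x) `^ p)%:E by rewrite lee_fin powR_ge0.
  apply: (@le_lt_trans _ _ (\int[mu]_(x in D)
      ((c `^ p)%:E * (Normc.normc (w x) `^ p)%:E))); last first.
    rewrite ge0_integralZl//.
    - by rewrite lte_mul_pinfty// lee_fin powR_ge0.
    - exact: measurable_funTS.
    - by rewrite lee_fin powR_ge0.
  rewrite [leRHS]integral_mkcond; apply: ae_ge0_le_integral => //.
  - by move=> x _; rewrite lee_fin powR_ge0.
  - apply/measurable_EFinP; apply: measurable_normc_powR.
    exact/cmeasurableM/cmeasurable_condexp.
  - by move=> x _; apply: erestrict_ge0 => t _; rewrite mule_ge0// lee_fin powR_ge0.
  - apply/(measurable_restrictT _ mD).1; apply: measurable_funTS.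
    exact: emeasurable_funM.
  - apply: filterS (normc_condexp_le mk k0 kK muf uf) => x Ex _.
    have {}Ex := le_trans Ex (leeD (KM x) (KM x)).
    rewrite /wct Normc.normcM powRM ?normc_ge0//.
    move: Ex; rewrite !patchE; case: ifPn => _.
      rewrite -EFinD lee_fin => Ex; rewrite -EFinM lee_fin [leLHS]mulrC.
      apply: ler_wpM2r; first exact: powR_ge0.
      by apply: ge0_ler_powR => //; rewrite ?nnegrE ?normc_ge0// ltW.
    rewrite adde0 lee_fin => Ex.
    have -> : Normc.normc (condexp mu A (fun y => (u y * f y)%R) x) = 0%R.
      by apply/eqP; rewrite eq_le normc_ge0 andbT.
    by rewrite powR0 ?gt_eqF// mulr0.
Qed.

End wct_domain_members.

(** * Density *)

Lemma condexp_ge0_eq0 (d : measure_display) (T : measurableType d)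
    (R : realType) (mu : {measure set T -> \bar R}) (A : set (set T))
    (subA : sub_sigma_algebra_of_measurable A) (sfA : sigma_finite_on mu A)
    (f : T -> R) (S : set T) :
  measurable_fun setT f -> (forall x, 0 <= f x) -> A S ->
  {ae mu, forall x, S x -> condexp_ge0 mu A (fun y => (f y)%:E) x = 0%E} ->
  {ae mu, forall x, S x -> f x = 0}.
Proof.
move=> mf f0 AS Ef0; have [mE E0 fE] := condexp_ge0P subA sfA mf f0.
have mS := subA.2 _ AS.
have mEf : measurable_fun S (EFin \o f).
  by apply: measurable_funTS; exact/measurable_EFinP.
have iEf : (\int[mu]_(x in S) `|(EFin \o f) x| = 0)%E.
  under eq_integral => x _ do rewrite /= ger0_norm//.
  rewrite (fE _ AS) -(integral0 mu S); apply: ae_eq_integral => //.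
  by apply: measurable_funTS; exact: (measurable_fun_sub subA mE).
have := (ae_eq_integral_abs mu mS mEf).1 iEf.
by apply: filterS => x Sx /Sx /= [].
Qed.

(** An infinite factor W^(1/p) leaves a finite product only if the other factor
    vanishes, and a nonnegative function vanishes a.e. on any A-measurable set on
    which its conditional expectation does. *)
Lemma ae_eq0_where_condexp_infinite (d : measure_display)
    (T : measurableType d) (R : realType) (mu : {measure set T -> \bar R})
    (A : set (set T)) (subA : sub_sigma_algebra_of_measurable A)
    (sfA : sigma_finite_on mu A) (p q : R) (u w : T -> R[i]) :
  0 < p -> 0 < q -> cmeasurable u -> cmeasurable w ->
  {ae mu, forall x,
    (condexp_ge0 mu A (fun y => (Normc.normc (w y) `^ p)%:E) x `^ p^-1 *
     condexp_ge0 mu A (fun y => (Normc.normc (u y) `^ q)%:E) x `^ q^-1 < +oo)%E} ->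
  {ae mu, forall x,
    condexp_ge0 mu A (fun y => (Normc.normc (w y) `^ p)%:E) x = +oo%E ->
    u x = 0}.
Proof.
move=> p0 q0 meas_u meas_w fin_wu.
set W := condexp_ge0 mu A (fun y => (Normc.normc (w y) `^ p)%:E).
pose V := condexp_ge0 mu A (fun y => (Normc.normc (u y) `^ q)%:E).
have npow_ge0 h r (y : T) : 0 <= Normc.normc (h y : R[i]) `^ r by exact: powR_ge0.
have [mW _ _] := condexp_ge0P subA sfA (measurable_normc_powR p meas_w) (npow_ge0 w p).
have [_ V0 _] := condexp_ge0P subA sfA (measurable_normc_powR q meas_u) (npow_ge0 u q).
have AWoo : A [set x | W x = +oo%E].
  rewrite -(g_sigma_measurableE subA) -[X in measurable X]setTI.
  exact: (mW measurableT [set +oo%E]).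
have : {ae mu, forall x, [set x | W x = +oo%E] x -> V x = 0%E}.
  apply: filterS fin_wu => x /[swap] /= Woo; rewrite -/(W x) Woo -/(V x).
  rewrite poweRyr ?invr_neq0 ?gt_eqF// => Voo.
  apply/eqP; apply: contraTT Voo => Vx0.
  rewrite gt0_mulye ?ltxx// poweR_gt0//.
  by rewrite lt0e Vx0 V0.
move/(condexp_ge0_eq0 subA sfA (measurable_normc_powR q meas_u) (npow_ge0 u q) AWoo).
apply: filterS => x /[apply] /powR_eq0_eq0; exact: Normc.eq0_normc.
Qed.

Theorem theorem2p1 (d : measure_display) (T : measurableType d) (R : realType)
    (mu : {sigma_finite_measure set T -> \bar R}) (A : set (set T))
    (subA : sub_sigma_algebra_of_measurable A)
    (sfA : sigma_finite_on mu A)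
    (u w : T -> R[i])
    (meas_u : cmeasurable u) (meas_w : cmeasurable w)
    (cond_u : conditionable mu A u) (cond_w : conditionable mu A w)
    (p q : R) (p1 : 1 <= p) (q1 : 1 <= q) (pq : p^-1 + q^-1 = 1)
    (fin_wu : {ae mu, forall x,
      (condexp_ge0 mu A (fun y => (Normc.normc (w y) `^ p)%:E) x `^ p^-1 *
       condexp_ge0 mu A (fun y => (Normc.normc (u y) `^ q)%:E) x `^ q^-1 < +oo)%E}) :
  dense_in_cLp mu p (wct_domain mu A p w u).
Proof.
have p0 : 0 < p by exact: lt_le_trans p1.
have q0 : 0 < q by exact: lt_le_trans q1.
split=> [f []//|f fp e e0]; have [mf _] := fp.
pose W := condexp_ge0 mu A (fun y => (Normc.normc (w y) `^ p)%:E).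
pose U := condexp_ge0 mu A (fun y => (Normc.normc (u y))%:E).
have npow_ge0 h r (y : T) : 0 <= Normc.normc (h y : R[i]) `^ r by exact: powR_ge0.
have [mW W0 EW] := condexp_ge0P subA sfA (measurable_normc_powR p meas_w) (npow_ge0 w p).
have [mU U0 _] := condexp_ge0P subA sfA (measurable_normc meas_u)
  (fun y => normc_ge0 (u y)).
have AW (B : set (\bar R)) : measurable B -> A (W @^-1` B).
  by move=> mB; rewrite -(g_sigma_measurableE subA) -[X in measurable X]setTI; exact: mW.
have AU (B : set (\bar R)) : measurable B -> A (U @^-1` B).
  by move=> mB; rewrite -(g_sigma_measurableE subA) -[X in measurable X]setTI; exact: mU.
have u0 := ae_eq0_where_condexp_infinite subA sfA p0 q0 meas_u meas_w fin_wu.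
have [G [TG ndG AG Goo]] := sub_sigma_finite_seq subA sfA.
pose C n := [set y : \bar R | (y <= n%:R%:E)%E].
have mC n : measurable (C n) by rewrite /C -set_itvNyc; exact: emeasurable_itv.
(* F n differs from the A-measurable set D n by the bound on f and by points
   where W is infinite, hence where u vanishes. *)
pose D n := G n `&` (U @^-1` C n `&` W @^-1` C n).
pose F n := [set x | Normc.normc (f x) <= n%:R] `&`
  (G n `&` (U @^-1` C n `&` W @^-1` (C n `|` [set +oo%E]))).
have AD n : A (D n).
  by apply: (sub_setI subA) => //; apply: (sub_setI subA); [exact: AU|exact: AW].
have mF n : measurable (F n).
  apply: measurableI.
    rewrite -[X in measurable X]setTI; apply: measurable_fun_le => //.
    exact: measurable_normc.
  apply: subA.2; apply: (sub_setI subA) => //; apply: (sub_setI subA).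
    exact: AU.
  by apply: AW; exact: measurableU.
have cvgF : {ae mu, forall x, \forall n \near \oo, F n x}.
  apply: filterS cond_u => x; rewrite -/(U x) => Ux.
  have Ufin : U x \is a fin_num by rewrite ge0_fin_numE//; exact: U0.
  have [i _ Gi] : (\bigcup_n G n) x by rewrite TG.
  near=> n; split => /=; [|split; [|split]].
  - by near: n; exact: nbhs_infty_ger.
  - have : (i <= n)%N by near: n; exact: nbhs_infty_ge.
    by move/ndG/subsetPset; apply.
  - by rewrite /C /= -(fineK Ufin) lee_fin; near: n; exact: nbhs_infty_ger.
  - have [->|Woo] := eqVneq (W x) +oo%E; [by right|left].
    have Wfin : W x \is a fin_num by rewrite ge0_fin_numE ?ltey//; exact: W0.
    by rewrite /C /= -(fineK Wfin) lee_fin; near: n; exact: nbhs_infty_ger.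
have [n fn] := cLp_patch_approx p0 mF cvgF fp e0.
exists (patch (fun=> 0) (F n) f) => //.
have mfn : cmeasurable (patch (fun=> 0) (F n) f) by exact: cmeasurable_patch.
apply: (@wct_domain_dominated _ _ _ mu A subA sfA p n%:R w u _ (D n)) => //.
- apply/(cLpE _ _ p0); split => //.
  have [_] := (cLpE mu f p0).1 fp; apply: le_lt_trans.
  apply: ge0_le_integral => //.
  - by move=> x _; rewrite lee_fin.
  - by apply/measurable_EFinP; exact: measurable_normc_powR.
  - by apply/measurable_EFinP; exact: measurable_normc_powR.
  - move=> x _; rewrite lee_fin /patch; case: ifP => // _.
    by rewrite Normc.normc0 powR0 ?gt_eqF.
- rewrite EW//; have mD := subA.2 _ (AD n).
  apply: (@le_lt_trans _ _ (\int[mu]_(x in D n) (cst n%:R%:E) x)%E).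
    apply: ge0_le_integral => //.
    - by apply: measurable_funTS; exact: (measurable_fun_sub subA mW).
    - by move=> x [_ []].
  rewrite integral_cst// lte_mul_pinfty//; apply: le_lt_trans (Goo n).
  by apply: le_measure; rewrite ?inE//; [exact: subA.2|exact: subIsetl].
- by move=> x; rewrite inE => -[_ []].
- apply: filterS u0 => x u0x; rewrite {1}/patch; case: ifPn; last first.
    move=> _; rewrite mulr0 Normc.normc0; apply: erestrict_ge0 => t _.
    by rewrite mule_ge0// lee_fin ?normc_ge0.
  rewrite inE => -[/= fxn [Gx [Ux [Wx|/u0x ux0]]]].
    rewrite patchE mem_set; last by split.
    by rewrite -EFinM lee_fin Normc.normcM mulrC ler_wpM2r// normc_ge0.
  rewrite ux0 mul0r Normc.normc0; apply: erestrict_ge0 => t _.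
  by rewrite mule_ge0// lee_fin ?normc_ge0.
Unshelve. all: by end_near. Qed.
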